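(* Let $\Gamma$ be a group, let $\mathcal M=(B,D,d)$ be an abelian $\Gamma$-crossed module, let $Q$ be a $\Gamma$-module and let $\psi:Q\to\mathrm{Coker}\,d$ be a homomorphism of $\Gamma$-modules. Let $h\in Z^3_{\Gamma,s}(\mathrm{Coker}\,d,\mathrm{Ker}\,d)$ be the 3-cocycle of the reduced $\Gamma$-graded Picard category of $\mathbb G_{\mathcal M}$. Then the vanishing of the class $\overline{\psi^*h}$ in $H^3_{\Gamma,s}(Q,\mathrm{Ker}\,d)$ is necessary and sufficient for the existence of a $\Gamma$-module extension of $B$ by $Q$ of type $\mathcal M$ inducing $\psi$. Further, if $\overline{\psi^*h}$ vanishes, then the set of equivalence classes of such extensions is in bijection with $H^2_{\Gamma,s}(Q,\mathrm{Ker}\,d)$.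
   Context: All groups here are abelian and written additively. An abelian $\Gamma$-crossed module $\mathcal M=(B,D,d)$ is a homomorphism $d:B\to D$ of $\Gamma$-modules (with $D$ acting trivially on $B$ and zero braiding map). **Extensions of type $\mathcal M$.** A $\Gamma$-module extension of $B$ by $Q$ of type $\mathcal M$ is a short exact sequence of $\Gamma$-modules $0\to B\xrightarrow{j}E\xrightarrow{p}Q\to0$ together with a $\Gamma$-module homomorphism $\varepsilon:E\to D$ with $\varepsilon j=d$. Two such extensions $(E,j,p,\varepsilon)$, $(E',j',p',\varepsilon')$ are equivalent if there is a $\Gamma$-module homomorphism $\alpha:E\to E'$ with $\alpha j=j'$, $p'\alpha=p$, $\varepsilon'\alpha=\varepsilon$. With $q:D\to\mathrm{Coker}\,d$ the projection, the extension induces the unique $\Gamma$-module homomorphism $\psi:Q\to\mathrm{Coker}\,d$ with $\psi p=q\varepsilon$. **Symmetric cohomology of $\Gamma$-modules (degrees 2, 3).** Let $M,N$ be $\Gamma$-modules. All cochains are normalized, i.e. vanish whenever some argument is $0\in M$ or $1\in\Gamma$. 1-cochains are functions $g:M\to N$, with coboundary $(\partial g)(r,s)=g(r)+g(s)-g(r+s)$, $(\partial g)(r,\sigma)=\sigma g(r)-g(\sigma r)$. 2-cochains are functions $f:M^2\cup(M\times\Gamma)\to N$, with coboundary $(\partial f)(r,s,t)=f(s,t)-f(r+s,t)+f(r,s+t)-f(r,s)$, $(\partial f)(r,s)=f(s,r)-f(r,s)$, $(\partial f)(r,s,\sigma)=f(r,\sigma)+f(s,\sigma)+f(\sigma r,\sigma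 s)-\sigma f(r,s)-f(r+s,\sigma)$, $(\partial f)(r,\tau,\sigma)=\tau f(r,\sigma)+f(\sigma r,\tau)-f(r,\tau\sigma)$. $Z^2_{\Gamma,s}(M,N)$ is the group of 2-cochains with $\partial f=0$, and $H^2_{\Gamma,s}(M,N)=Z^2_{\Gamma,s}(M,N)/\{\partial g\}$. 3-cochains are functions $h:M^3\cup M^2\cup(M^2\times\Gamma)\cup(M\times\Gamma^2)\to N$. $Z^3_{\Gamma,s}(M,N)$ is the group of those satisfying, for $r,s,t,w\in M$, $\sigma,\tau,\gamma\in\Gamma$: $h(r,s,t+w)+h(r+s,t,w)=h(s,t,w)+h(r,s+t,w)+h(r,s,t)$; $h(r,s)+h(s,r)=0$; $h(r,s)+h(s,r,t)+h(r,t)=h(r,s,t)+h(r,s+t)+h(s,t,r)$; $h(\sigma r,\sigma s,\sigma t)+h(r,s,\sigma)+h(r+s,t,\sigma)=\sigma h(r,s,t)+h(s,t,\sigma)+h(r,s+t,\sigma)$; $h(\sigma r,\sigma s)+h(r,s,\sigma)=\sigma h(r,s)+h(s,r,\sigma)$; $h(\sigma r,\sigma s,\tau)+\tau h(r,s,\sigma)+h(r+s,\tau,\sigma)=h(r,\tau,\sigma)+h(s,\tau,\sigma)+h(r,s,\tau\sigma)$; $\gamma h(r,\tau,\sigma)+h(r,\gamma,\tau\sigma)=h(\sigma r,\gamma,\tau)+h(r,\gamma\tau,\sigma)$. $H^3_{\Gamma,s}(M,N)=Z^3_{\Gamma,s}(M,N)/\{\partial f\}$, and $\overline{h}$ denotes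 the class of $h$. For a $\Gamma$-module homomorphism $\psi:Q\to M$, $\psi^*h$ is obtained by applying $\psi$ to the module arguments. **The cocycle $h$.** $\mathbb G_{\mathcal M}$ is the $\Gamma$-graded symmetric monoidal groupoid whose objects are the elements of $D$, whose morphisms $x\to y$ of grade $\sigma\in\Gamma$ are pairs $(b,\sigma)$, $b\in B$, with $\sigma x=d(b)+y$, with composite of $(b,\sigma):x\to y$ followed by $(c,\tau):y\to z$ equal to $(\tau b+c,\tau\sigma)$, tensor product given by addition, and all constraints identities. Its reduced graded Picard category is determined by a 3-cocycle $h$, well defined up to coboundary, obtained as follows. Choose a set-theoretic section $u:\mathrm{Coker}\,d\to D$ of $q$ with $u(0)=0$, and a normalized function $f:(\mathrm{Coker}\,d)^2\cup(\mathrm{Coker}\,d\times\Gamma)\to B$ with $u(r)+u(s)=d f(r,s)+u(r+s)$ and $\sigma u(r)=d f(r,\sigma)+u(\sigma r)$. Then $h$ is given by the displayed formulas for $\partial f$ (computed in $B$, using the $\Gamma$-actions on $B$ and on $\mathrm{Coker}\,d$); its values lie in $\mathrm{Ker}\,d$ and $h\in Z^3_{\Gamma,s}(\mathrm{Coker}\,d,\mathrm{Ker}\,d)$. *)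

(* Defs.v *)
From HB Require Import structures.
From mathcomp Require Import all_boot all_order all_algebra.
From mathcomp Require Import ring_quotient.
From mathcomp Require Import boolp functions.

Set Implicit Arguments.
Unset Strict Implicit.
Unset Printing Implicit Defensive.

Import GRing.Theory.
Local Open Scope ring_scope.
Local Open Scope quotient_scope.

(* The tactic zmod decides identities in abelian groups, by comparing the
   multiplicities of the atoms on the two sides. *)
Inductive zexp := ZVar of nat | ZZero | ZAdd of zexp & zexp | ZOpp of zexp.

Fixpoint zexp_val (V : zmodType) (e : seq V) (t : zexp) : V :=
  match t with
  | ZVar i => e`_i
  | ZZero => 0
  | ZAdd t1 t2 => zexp_val e t1 + zexp_val e t2
  | ZOpp t1 => - zexp_val e t1
  end.

Fixpoint zexp_mult (t : zexp) (j : nat) : int :=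
  match t with
  | ZVar i => if j == i then 1 else 0
  | ZZero => 0
  | ZAdd t1 t2 => zexp_mult t1 j + zexp_mult t2 j
  | ZOpp t1 => - zexp_mult t1 j
  end.

Lemma zexp_valE (V : zmodType) (e : seq V) t :
  zexp_val e t = \sum_(j < size e) e`_j *~ zexp_mult t j.
Proof.
elim: t => [i||t1 IH1 t2 IH2|t1 IH1] /=.
- have [lt_i|le_i] := ltnP i (size e); last first.
    rewrite nth_default // big1 // => j _.
    by rewrite (ltn_eqF (leq_trans (ltn_ord j) le_i)).
  rewrite (bigD1 (Ordinal lt_i)) //= eqxx big1 ?addr0 // => j /negPf ne_j.
  by rewrite -[_ == i]/(j == Ordinal lt_i) ne_j.
- by rewrite big1.
- by rewrite IH1 IH2 -big_split; apply: eq_bigr => j _; rewrite mulrzDr.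
- by rewrite IH1 -sumrN; apply: eq_bigr => j _; rewrite mulrNz.
Qed.

Lemma zexpP (V : zmodType) (e : seq V) t1 t2 :
  all (fun j => zexp_mult t1 j == zexp_mult t2 j) (iota 0 (size e)) ->
  zexp_val e t1 = zexp_val e t2.
Proof.
move=> /allP eq12; rewrite !zexp_valE; apply: eq_bigr => j _.
by rewrite (eqP (eq12 j _)) // mem_iota ltn_ord.
Qed.

Ltac zmod_index x e :=
  match e with
  | ?y :: _ => let eq_xy := constr:(erefl x : x = y) in constr:(0%N)
  | _ :: ?e' => let i := zmod_index x e' in constr:(S i)
  end.
Ltac zmod_insert x e :=
  match e with
  | _ => let i := zmod_index x e in e
  | _ => constr:(x :: e)
  end.
Ltac zmod_atoms t e :=
  lazymatch t with
  | (?x + ?y)%R => let e' := zmod_atoms x e in zmod_atoms y e'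
  | (- ?x)%R => zmod_atoms x e
  | 0%R => e
  | _ => zmod_insert t e
  end.
Ltac zmod_reify t e :=
  lazymatch t with
  | (?x + ?y)%R => let a := zmod_reify x e in let b := zmod_reify y e in
      constr:(ZAdd a b)
  | (- ?x)%R => let a := zmod_reify x e in constr:(ZOpp a)
  | 0%R => constr:(ZZero)
  | _ => let i := zmod_index t e in constr:(ZVar i)
  end.
Ltac zmod :=
  lazymatch goal with
  | |- @eq ?T ?x ?y =>
      let e0 := zmod_atoms x (@nil T) in
      let e := zmod_atoms y e0 in
      let a := zmod_reify x e in
      let b := zmod_reify y e in
      exact: (@zexpP _ e a b isT)
  end.

HB.mixin Record isGModule (Gamma : groupType) M of GRing.Zmodule M := {
  gact : Gamma -> M -> M;
  gact1 : forall x, gact 1%g x = x;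
  gactM : forall s t x, gact (s * t)%g x = gact s (gact t x);
  gactD : forall s x y, gact s (x + y) = gact s x + gact s y
}.

#[short(type="gmodType")]
HB.structure Definition GModule (Gamma : groupType) :=
  {M of isGModule Gamma M & GRing.Zmodule M}.

Notation "s ** x" := (gact s x) (at level 40, left associativity) : ring_scope.

HB.mixin Record isGEquivariant (Gamma : groupType) (M N : gmodType Gamma)
    (f : M -> N) := {
  ghomE : forall s x, f (s ** x) = s ** f x
}.

HB.structure Definition GHom (Gamma : groupType) (M N : gmodType Gamma) :=
  {f of isGEquivariant Gamma M N f & @GRing.Additive M N f}.

Notation "{ 'ghom' M -> N }" := (GHom.type M N)
  (at level 0, M at level 98, N at level 99,
   format "{ 'ghom'  M  ->  N }") : type_scope.

Section GActTheory.
Variables (Gamma : groupType) (M : gmodType Gamma).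
Implicit Types (s : Gamma) (x y : M).

Lemma gact0 s : s ** (0 : M) = 0.
Proof. by apply: (@addIr _ (s ** (0 : M))); rewrite -gactD !add0r. Qed.

Lemma gactN s x : s ** (- x) = - (s ** x).
Proof. by apply/eqP; rewrite -addr_eq0 -gactD addNr gact0. Qed.

Lemma gactB s x y : s ** (x - y) = s ** x - s ** y.
Proof. by rewrite gactD gactN. Qed.

End GActTheory.

(* An abelian Gamma-crossed module (B, D, d) is just d : {ghom B -> D}. *)
Section KerCoker.
Variables (Gamma : groupType) (B D : gmodType Gamma) (d : {ghom B -> D}).

Definition gker_pred : {pred B} := fun b => d b == 0.

Fact gker_zmod_closed : zmod_closed gker_pred.
Proof.
split=> [|x y]; rewrite !unfold_in ?raddf0 // => /eqP dx /eqP dy.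
by rewrite raddfB /= dx dy subr0.
Qed.

HB.instance Definition _ := GRing.isZmodClosed.Build B gker_pred gker_zmod_closed.

Record gker := GKer { gker_val : B; _ : gker_val \in gker_pred }.

HB.instance Definition _ := [isSub for gker_val].
HB.instance Definition _ := [Choice of gker by <:].
HB.instance Definition _ := [SubChoice_isSubZmodule of gker by <:].

Fact gker_act_subproof (s : Gamma) (x : gker) : s ** val x \in gker_pred.
Proof.
by case: x => x /= /eqP dx; rewrite unfold_in; apply/eqP; rewrite ghomE dx gact0.
Qed.

Definition gker_act (s : Gamma) (x : gker) : gker :=
  GKer (gker_act_subproof s x).

Fact gker_act1 x : gker_act 1%g x = x.
Proof. by apply: val_inj; rewrite /= gact1. Qed.
Fact gker_actM s t x : gker_act (s * t)%g x = gker_act s (gker_act t x).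
Proof. by apply: val_inj; rewrite /= gactM. Qed.
Fact gker_actD s x y : gker_act s (x + y) = gker_act s x + gker_act s y.
Proof. by apply: val_inj; rewrite [RHS](raddfD val); exact: gactD. Qed.

HB.instance Definition _ :=
  isGModule.Build Gamma gker gker_act1 gker_actM gker_actD.

Definition gim_pred : {pred D} := fun y => `[< exists b, y = d b >].

Fact gim_zmod_closed : zmod_closed gim_pred.
Proof.
split=> [|x y]; first by apply/asboolP; exists 0; rewrite raddf0.
move=> /asboolP[a ->] /asboolP[b ->].
by apply/asboolP; exists (a - b); rewrite raddfB.
Qed.

HB.instance Definition _ := GRing.isZmodClosed.Build D gim_pred gim_zmod_closed.

Definition gcoker := Quotient.quot gim_pred.

HB.instance Definition _ := GRing.Zmodule.on gcoker.

Definition gcoker_proj (x : D) : gcoker := \pi_gcoker x.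

Lemma gcoker_projD x y : gcoker_proj (x + y) = gcoker_proj x + gcoker_proj y.
Proof. exact: (raddfD \pi_gcoker). Qed.

Lemma gcoker_projP x y : gcoker_proj x = gcoker_proj y <-> exists b, x - y = d b.
Proof.
rewrite /gcoker_proj; split=> [e|[b e]].
  by apply/asboolP; rewrite -[`[< _ >]]/(_ \in gim_pred) Quotient.idealrBE; apply/eqP.
apply/eqP; rewrite -Quotient.idealrBE; apply/asboolP; by exists b.
Qed.

Definition gcoker_act (s : Gamma) (x : gcoker) : gcoker :=
  gcoker_proj (s ** repr x).

Lemma gcoker_actE s x : gcoker_act s (gcoker_proj x) = gcoker_proj (s ** x).
Proof.
apply/gcoker_projP; have: gcoker_proj (repr (gcoker_proj x)) = gcoker_proj x.
  by rewrite /gcoker_proj reprK.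
by move=> /gcoker_projP[b eb]; exists (s ** b); rewrite -gactB eb ghomE.
Qed.

Lemma gcoker_surj (r : gcoker) : exists x, gcoker_proj x = r.
Proof. by exists (repr r); rewrite /gcoker_proj reprK. Qed.

Fact gcoker_act1 x : gcoker_act 1%g x = x.
Proof. by have [y <-] := gcoker_surj x; rewrite gcoker_actE gact1. Qed.
Fact gcoker_actM s t x : gcoker_act (s * t)%g x = gcoker_act s (gcoker_act t x).
Proof. by have [y <-] := gcoker_surj x; rewrite !gcoker_actE gactM. Qed.
Fact gcoker_actD s x y : gcoker_act s (x + y) = gcoker_act s x + gcoker_act s y.
Proof.
have [x' <-] := gcoker_surj x; have [y' <-] := gcoker_surj y.
by rewrite -gcoker_projD !gcoker_actE gactD gcoker_projD.
Qed.

HB.instance Definition _ :=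
  isGModule.Build Gamma gcoker gcoker_act1 gcoker_actM gcoker_actD.

End KerCoker.

Section Cohomology.
Variables (Gamma : groupType) (M N : gmodType Gamma).

Definition cochain1 := M -> N.

(* A cochain on a disjoint union of products is given by its restrictions to
   the components of the union. *)
Record cochain2 := Cochain2 {
  c2mm : M -> M -> N;
  c2mg : M -> Gamma -> N
}.

Record cochain3 := Cochain3 {
  c3mmm : M -> M -> M -> N;
  c3mm : M -> M -> N;
  c3mmg : M -> M -> Gamma -> N;
  c3mgg : M -> Gamma -> Gamma -> N
}.

Lemma cochain2P (f f' : cochain2) :
  (forall r s, c2mm f r s = c2mm f' r s) ->
  (forall r s, c2mg f r s = c2mg f' r s) -> f = f'.
Proof.
case: f f' => [f1 f2] [f1' f2'] /= e1 e2.
by congr Cochain2; apply/funext => r; apply/funext => s.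
Qed.

Lemma cochain3P (h h' : cochain3) :
  (forall r s t, c3mmm h r s t = c3mmm h' r s t) ->
  (forall r s, c3mm h r s = c3mm h' r s) ->
  (forall r s t, c3mmg h r s t = c3mmg h' r s t) ->
  (forall r s t, c3mgg h r s t = c3mgg h' r s t) -> h = h'.
Proof.
case: h h' => [h1 h2 h3 h4] [h1' h2' h3' h4'] /= e1 e2 e3 e4.
congr Cochain3; apply/funext => r; apply/funext => s //;
  by apply/funext => t.
Qed.

HB.instance Definition _ := gen_eqMixin cochain2.
HB.instance Definition _ := gen_choiceMixin cochain2.
HB.instance Definition _ := gen_eqMixin cochain3.
HB.instance Definition _ := gen_choiceMixin cochain3.

Definition cochain2_zero : cochain2 := Cochain2 (fun _ _ => 0) (fun _ _ => 0).
Definition cochain2_opp (f : cochain2) : cochain2 :=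
  Cochain2 (fun r s => - c2mm f r s) (fun r s => - c2mg f r s).
Definition cochain2_add (f f' : cochain2) : cochain2 :=
  Cochain2 (fun r s => c2mm f r s + c2mm f' r s)
           (fun r s => c2mg f r s + c2mg f' r s).

Fact cochain2_addA : associative cochain2_add.
Proof. by move=> x y z; apply: cochain2P => *; apply: addrA. Qed.
Fact cochain2_addC : commutative cochain2_add.
Proof. by move=> x y; apply: cochain2P => *; apply: addrC. Qed.
Fact cochain2_add0 : left_id cochain2_zero cochain2_add.
Proof. by move=> x; apply: cochain2P => *; apply: add0r. Qed.
Fact cochain2_addN : left_inverse cochain2_zero cochain2_opp cochain2_add.
Proof. by move=> x; apply: cochain2P => *; apply: addNr. Qed.

HB.instance Definition _ := GRing.isZmodule.Build cochain2
  cochain2_addA cochain2_addC cochain2_add0 cochain2_addN.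

Definition cochain3_zero : cochain3 :=
  Cochain3 (fun _ _ _ => 0) (fun _ _ => 0) (fun _ _ _ => 0) (fun _ _ _ => 0).
Definition cochain3_opp (h : cochain3) : cochain3 :=
  Cochain3 (fun r s t => - c3mmm h r s t) (fun r s => - c3mm h r s)
           (fun r s t => - c3mmg h r s t) (fun r s t => - c3mgg h r s t).
Definition cochain3_add (h h' : cochain3) : cochain3 :=
  Cochain3 (fun r s t => c3mmm h r s t + c3mmm h' r s t)
           (fun r s => c3mm h r s + c3mm h' r s)
           (fun r s t => c3mmg h r s t + c3mmg h' r s t)
           (fun r s t => c3mgg h r s t + c3mgg h' r s t).

Fact cochain3_addA : associative cochain3_add.
Proof. by move=> x y z; apply: cochain3P => *; apply: addrA. Qed.
Fact cochain3_addC : commutative cochain3_add.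
Proof. by move=> x y; apply: cochain3P => *; apply: addrC. Qed.
Fact cochain3_add0 : left_id cochain3_zero cochain3_add.
Proof. by move=> x; apply: cochain3P => *; apply: add0r. Qed.
Fact cochain3_addN : left_inverse cochain3_zero cochain3_opp cochain3_add.
Proof. by move=> x; apply: cochain3P => *; apply: addNr. Qed.

HB.instance Definition _ := GRing.isZmodule.Build cochain3
  cochain3_addA cochain3_addC cochain3_add0 cochain3_addN.

Definition normalized1 (g : cochain1) : Prop := g 0 = 0.

Definition normalized2 (f : cochain2) : Prop :=
  [/\ forall r, c2mm f 0 r = 0, forall r, c2mm f r 0 = 0,
      forall s, c2mg f 0 s = 0 & forall r, c2mg f r 1%g = 0].

Definition normalized3 (h : cochain3) : Prop :=
  [/\ forall r s, [/\ c3mmm h 0 r s = 0, c3mmm h r 0 s = 0 & c3mmm h r s 0 = 0],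
      forall r, c3mm h 0 r = 0 /\ c3mm h r 0 = 0,
      forall r s, [/\ c3mmg h 0 r s = 0, c3mmg h r 0 s = 0
                    & forall r', c3mmg h r r' 1%g = 0]
    & forall r s t, [/\ c3mgg h 0 s t = 0, c3mgg h r 1%g t = 0
                      & c3mgg h r s 1%g = 0]].

Definition cobord1 (g : cochain1) : cochain2 := Cochain2
  (fun r s => g r + g s - g (r + s))
  (fun r sg => sg ** g r - g (sg ** r)).

Definition cobord2 (f : cochain2) : cochain3 := Cochain3
  (fun r s t => c2mm f s t - c2mm f (r + s) t + c2mm f r (s + t) - c2mm f r s)
  (fun r s => c2mm f s r - c2mm f r s)
  (fun r s sg => c2mg f r sg + c2mg f s sg + c2mm f (sg ** r) (sg ** s)
                 - sg ** c2mm f r s - c2mg f (r + s) sg)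
  (fun r ta sg => ta ** c2mg f r sg + c2mg f (sg ** r) ta
                  - c2mg f r (ta * sg)%g).

Definition cocycle2 (f : cochain2) : Prop := normalized2 f /\ cobord2 f = 0.

Definition cocycle3 (h : cochain3) : Prop :=
  [/\ normalized3 h,
      [/\ forall r s t w, c3mmm h r s (t + w) + c3mmm h (r + s) t w =
            c3mmm h s t w + c3mmm h r (s + t) w + c3mmm h r s t,
          forall r s, c3mm h r s + c3mm h s r = 0
        & forall r s t, c3mm h r s + c3mmm h s r t + c3mm h r t =
            c3mmm h r s t + c3mm h r (s + t) + c3mmm h s t r]
    & [/\ forall r s t sg,
            c3mmm h (sg ** r) (sg ** s) (sg ** t)
              + c3mmg h r s sg + c3mmg h (r + s) t sg =
            sg ** c3mmm h r s t + c3mmg h s t sg + c3mmg h r (s + t) sg,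
          forall r s sg, c3mm h (sg ** r) (sg ** s) + c3mmg h r s sg =
            sg ** c3mm h r s + c3mmg h s r sg,
          forall r s ta sg,
            c3mmg h (sg ** r) (sg ** s) ta
              + ta ** c3mmg h r s sg + c3mgg h (r + s) ta sg =
            c3mgg h r ta sg + c3mgg h s ta sg + c3mmg h r s (ta * sg)%g
        & forall r ga ta sg,
            ga ** c3mgg h r ta sg + c3mgg h r ga (ta * sg)%g =
            c3mgg h (sg ** r) ga ta + c3mgg h r (ga * ta)%g sg]].

Lemma c2mmB f f' r s : c2mm (f - f') r s = c2mm f r s - c2mm f' r s.
Proof. by []. Qed.
Lemma c2mgB f f' r s : c2mg (f - f') r s = c2mg f r s - c2mg f' r s.
Proof. by []. Qed.
Lemma c3mmmB h h' r s t : c3mmm (h - h') r s t = c3mmm h r s t - c3mmm h' r s t.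
Proof. by []. Qed.
Lemma c3mmB h h' r s : c3mm (h - h') r s = c3mm h r s - c3mm h' r s.
Proof. by []. Qed.
Lemma c3mmgB h h' r s t : c3mmg (h - h') r s t = c3mmg h r s t - c3mmg h' r s t.
Proof. by []. Qed.
Lemma c3mggB h h' r s t : c3mgg (h - h') r s t = c3mgg h r s t - c3mgg h' r s t.
Proof. by []. Qed.

Definition cochainBE := (c2mmB, c2mgB, c3mmmB, c3mmB, c3mmgB, c3mggB).

Lemma cobord1B g g' : cobord1 (g - g') = cobord1 g - cobord1 g'.
Proof.
have gB r : (g - g') r = g r - g' r by [].
by apply: cochain2P => r s; rewrite cochainBE /= !gB ?gactB; zmod.
Qed.

Lemma cobord2B f f' : cobord2 (f - f') = cobord2 f - cobord2 f'.
Proof.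
apply: cochain3P => [r s t|r s|r s t|r s t].
- rewrite c3mmmB /=; zmod.
- rewrite c3mmB /=; zmod.
- rewrite c3mmgB /= !(gactD, gactN); zmod.
- rewrite c3mggB /= !(gactD, gactN); zmod.
Qed.

Definition Z2_pred : {pred cochain2} := fun f => `[< cocycle2 f >].
Definition Z3_pred : {pred cochain3} := fun h => `[< cocycle3 h >].

Fact Z2_zmod_closed : zmod_closed Z2_pred.
Proof.
have cobord20 : cobord2 0 = 0.
  by rewrite -[X in cobord2 X](subrr 0) cobord2B subrr.
split=> [|f f']; first exact/asboolP.
move=> /asboolP[[n1 n2 n3 n4] c] /asboolP[[n1' n2' n3' n4'] c'].
apply/asboolP; split; last by rewrite cobord2B c c' subrr.
by split=> r; rewrite cochainBE (n1, n2, n3, n4) (n1', n2', n3', n4') subrr.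
Qed.

Fact Z3_zmod_closed : zmod_closed Z3_pred.
Proof.
have BDB (V : zmodType) (a a' b b' : V) : a - a' + (b - b') = a + b - (a' + b').
  by rewrite opprD addrACA.
split=> [|h h'].
  apply/asboolP; split; split=> *; try split=> *;
    by rewrite /= ?gact0 ?addr0.
move=> /asboolP[[n1 n2 n3 n4] [c1 c2 c3] [c4 c5 c6 c7]].
move=> /asboolP[[n1' n2' n3' n4'] [c1' c2' c3'] [c4' c5' c6' c7']].
apply/asboolP; split; split.
- move=> r s; have [a b c] := n1 r s; have [a' b' c'] := n1' r s.
  by split; rewrite cochainBE (a, b, c) (a', b', c') subrr.
- move=> r; have [a b] := n2 r; have [a' b'] := n2' r.
  by split; rewrite cochainBE (a, b) (a', b') subrr.
- move=> r s; have [a b c] := n3 r s; have [a' b' c'] := n3' r s.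
  by split=> [||r']; rewrite cochainBE (a, b, c) (a', b', c') subrr.
- move=> r s t; have [a b c] := n4 r s t; have [a' b' c'] := n4' r s t.
  by split; rewrite cochainBE (a, b, c) (a', b', c') subrr.
- by move=> r s t w; rewrite !cochainBE !BDB c1 c1'.
- by move=> r s; rewrite !cochainBE !BDB c2 c2' subrr.
- by move=> r s t; rewrite !cochainBE !BDB c3 c3'.
- by move=> r s t sg; rewrite !cochainBE gactB !BDB c4 c4'.
- by move=> r s sg; rewrite !cochainBE gactB !BDB c5 c5'.
- by move=> r s ta sg; rewrite !cochainBE gactB !BDB c6 c6'.
- by move=> r ga ta sg; rewrite !cochainBE gactB !BDB c7 c7'.
Qed.

HB.instance Definition _ :=
  GRing.isZmodClosed.Build cochain2 Z2_pred Z2_zmod_closed.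
HB.instance Definition _ :=
  GRing.isZmodClosed.Build cochain3 Z3_pred Z3_zmod_closed.

Record Z2 := MkZ2 { z2val : cochain2; _ : z2val \in Z2_pred }.
Record Z3 := MkZ3 { z3val : cochain3; _ : z3val \in Z3_pred }.

HB.instance Definition _ := [isSub for z2val].
HB.instance Definition _ := [Choice of Z2 by <:].
HB.instance Definition _ := [SubChoice_isSubZmodule of Z2 by <:].
HB.instance Definition _ := [isSub for z3val].
HB.instance Definition _ := [Choice of Z3 by <:].
HB.instance Definition _ := [SubChoice_isSubZmodule of Z3 by <:].

Definition B2_pred : {pred Z2} := fun z =>
  `[< exists g : cochain1, normalized1 g /\ z2val z = cobord1 g >].
Definition B3_pred : {pred Z3} := fun z =>
  `[< exists f : cochain2, normalized2 f /\ z3val z = cobord2 f >].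

Fact B2_zmod_closed : zmod_closed B2_pred.
Proof.
have cobord10 : cobord1 0 = 0.
  by rewrite -[X in cobord1 X](subrr 0) cobord1B subrr.
split=> [|z z']; first by apply/asboolP; exists 0.
move=> /asboolP[g [n e]] /asboolP[g' [n' e']].
apply/asboolP; exists (g - g'); split.
  by rewrite /normalized1 -[LHS]/(g 0 - g' 0) n n' subrr.
by rewrite cobord1B -e -e'.
Qed.

Fact B3_zmod_closed : zmod_closed B3_pred.
Proof.
have cobord20 : cobord2 0 = 0.
  by rewrite -[X in cobord2 X](subrr 0) cobord2B subrr.
split=> [|z z']; first by apply/asboolP; exists 0.
move=> /asboolP[f [[n1 n2 n3 n4] e]] /asboolP[f' [[n1' n2' n3' n4'] e']].
apply/asboolP; exists (f - f'); split; last by rewrite cobord2B -e -e'.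
by split=> r; rewrite cochainBE (n1, n2, n3, n4) (n1', n2', n3', n4') subrr.
Qed.

HB.instance Definition _ := GRing.isZmodClosed.Build Z2 B2_pred B2_zmod_closed.
HB.instance Definition _ := GRing.isZmodClosed.Build Z3 B3_pred B3_zmod_closed.

Definition H2 := Quotient.quot B2_pred.
Definition H3 := Quotient.quot B3_pred.

HB.instance Definition _ := GRing.Zmodule.on H2.
HB.instance Definition _ := GRing.Zmodule.on H3.

Definition class3 (h : Z3) : H3 := \pi_H3 h.

Lemma class3_eq0 (h : Z3) :
  class3 h = 0 <-> exists f, normalized2 f /\ z3val h = cobord2 f.
Proof.
have -> : class3 h = 0 <-> h \in B3_pred; last by split=> /asboolP.
rewrite -[X in X \in _]subr0 Quotient.idealrBE.
have pi0 : class3 0 = 0 := raddf0 \pi_H3.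
split=> [e|/eqP e]; last by rewrite -pi0.
by apply/eqP; rewrite -[RHS]/(class3 0) pi0.
Qed.

Lemma cobord2_cocycle3 (f : cochain2) : normalized2 f -> cocycle3 (cobord2 f).
Proof.
have aA (x y z : M) : x + (y + z) = x + y + z by rewrite addrA.
have aC (x y : M) : x + y = y + x by rewrite addrC.
move=> [n1 n2 n3 n4]; split; split.
- by move=> r s; split; rewrite /= ?(add0r, addr0) ?n1 ?n2; zmod.
- by move=> r; split; rewrite /= n1 n2 subrr.
- move=> r s; split=> [||r']; rewrite /= ?(add0r, addr0, gact0, gact1);
    rewrite ?n1 ?n2 ?n3 ?n4 ?gact0; zmod.
- move=> r s t; split; rewrite /= ?(gact0, gact1, mulg1, mul1g);
    rewrite ?n3 ?n4 ?gact0; zmod.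
- by move=> r s t w; rewrite /= !(aA s) !(aA r); zmod.
- by move=> r s; rewrite /=; zmod.
- by move=> r s t; rewrite /= (aC s r) (aC t r); zmod.
- move=> r s t sg; rewrite /= !(gactD, gactN) !(aA r).
  zmod.
- by move=> r s sg; rewrite /= (aC s r) !(gactD, gactN); zmod.
- by move=> r s ta sg; rewrite /= !(gactD, gactN, gactM); zmod.
- by move=> r ga ta sg; rewrite /= !(gactD, gactN, gactM) mulgA; zmod.
Qed.

End Cohomology.

Section Pullback.
Variables (Gamma : groupType) (M Q N : gmodType Gamma) (psi : {ghom Q -> M}).

Definition cochain3_pull (h : cochain3 M N) : cochain3 Q N := Cochain3
  (fun r s t => c3mmm h (psi r) (psi s) (psi t))
  (fun r s => c3mm h (psi r) (psi s))
  (fun r s sg => c3mmg h (psi r) (psi s) sg)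
  (fun r ta sg => c3mgg h (psi r) ta sg).

Fact cochain3_pull_subproof (h : Z3 M N) :
  cochain3_pull (z3val h) \in @Z3_pred _ Q N.
Proof.
case: h => h /= /asboolP[[n1 n2 n3 n4] [c1 c2 c3] [c4 c5 c6 c7]].
have psi0 : psi 0 = 0 by exact: raddf0.
have psiD x y : psi (x + y) = psi x + psi y by exact: raddfD.
apply/asboolP; split; split.
- by move=> r s /=; rewrite psi0; apply: n1.
- by move=> r /=; rewrite psi0; apply: n2.
- by move=> r s; have [a b c] := n3 (psi r) s; split=> [||r'] /=; rewrite ?psi0.
- by move=> r s t /=; rewrite psi0; apply: n4.
- by move=> r s t w; rewrite /= !psiD; apply: c1.
- by move=> r s; apply: c2.
- by move=> r s t; rewrite /= !psiD; apply: c3.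
- by move=> r s t sg; rewrite /= !ghomE !psiD; apply: c4.
- by move=> r s sg; rewrite /= !ghomE; apply: c5.
- by move=> r s ta sg; rewrite /= !ghomE !psiD; apply: c6.
- by move=> r ga ta sg; rewrite /= !ghomE; apply: c7.
Qed.

Definition Z3_pull (h : Z3 M N) : Z3 Q N := MkZ3 (cochain3_pull_subproof h).

End Pullback.

Section ReducedCocycle.
Variables (Gamma : groupType) (B D : gmodType Gamma) (d : {ghom B -> D}).

(* Pushforward of a cochain along the inclusion Ker d -> B. *)
Definition cochain3_gker (M : gmodType Gamma) (h : cochain3 M (gker d)) :
    cochain3 M B := Cochain3
  (fun r s t => gker_val (c3mmm h r s t))
  (fun r s => gker_val (c3mm h r s))
  (fun r s sg => gker_val (c3mmg h r s sg))
  (fun r ta sg => gker_val (c3mgg h r ta sg)).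

(* The data from which the 3-cocycle of the reduced graded Picard category of
   G_M is computed, M = (B, D, d).  A morphism x -> y of grade sg in G_M is a
   pair (b, sg) with sg ** x = d b + y: the last two fields say that
   (f (r, s), 1) is a morphism u r + u s -> u (r + s) and that (f (r, sg), sg)
   is a morphism u r -> u (sg ** r). *)
Record gpic_reduction (u : gcoker d -> D) (f : cochain2 (gcoker d) B) : Prop := {
  gpic_u0 : u 0 = 0;
  gpic_uK : forall r, gcoker_proj d (u r) = r;
  gpic_norm : normalized2 f;
  gpic_add : forall r s, u r + u s = d (c2mm f r s) + u (r + s);
  gpic_act : forall r sg, sg ** u r = d (c2mg f r sg) + u (sg ** r)
}.

(* cobord2 f is computed in B, and h is cobord2 f with values in Ker d; as u
   and f vary, h runs over a whole class in H3 (gcoker d) (gker d). *)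
Definition gpic_cocycle (h : Z3 (gcoker d) (gker d)) : Prop :=
  exists u f, gpic_reduction u f /\ cochain3_gker (z3val h) = cobord2 f.

Lemma gpic_reduction_ker u f : gpic_reduction u f ->
  [/\ forall r s t, c3mmm (cobord2 f) r s t \in gker_pred d,
      forall r s, c3mm (cobord2 f) r s \in gker_pred d,
      forall r s sg, c3mmg (cobord2 f) r s sg \in gker_pred d
    & forall r ta sg, c3mgg (cobord2 f) r ta sg \in gker_pred d].
Proof.
case=> u0 uK _ fa fs.
have dD x y : d (x + y) = d x + d y by exact: raddfD.
have dN x : d (- x) = - d x by exact: raddfN.
have da r s : d (c2mm f r s) = u r + u s - u (r + s) by rewrite fa addrK.
have ds r sg : d (c2mg f r sg) = sg ** u r - u (sg ** r) by rewrite fs addrK.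
have aA (r s t : gcoker d) : r + (s + t) = r + s + t by rewrite addrA.
have aC (r s : gcoker d) : r + s = s + r by rewrite addrC.
split=> [r s t|r s|r s sg|r ta sg]; rewrite unfold_in; apply/eqP;
  rewrite /= !(dD, dN, ghomE, da, ds) ?(gactD, gactN, gactM, aA).
- by zmod.
- by rewrite (aC s r); zmod.
- by zmod.
- by zmod.
Qed.

Lemma gpic_cocycle_ex : exists h, gpic_cocycle h.
Proof.
have proj0 : gcoker_proj d 0 = 0 by exact: (raddf0 \pi_(gcoker d)).
pose u (r : gcoker d) : D := if r == 0 then 0 else repr r.
have u0 : u 0 = 0 by rewrite /u eqxx.
have uK r : gcoker_proj d (u r) = r.
  by rewrite /u; case: eqP => [->//|_]; rewrite /gcoker_proj reprK.
have projE (x y : D) : gcoker_proj d x = gcoker_proj d y ->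
    {b : B | x = d b + y}.
  move=> /gcoker_projP e; apply: cid; case: e => b e.
  by exists b; rewrite -e subrK.
have fa r s : gcoker_proj d (u r + u s) = gcoker_proj d (u (r + s)).
  by rewrite gcoker_projD !uK.
have fs sg r : gcoker_proj d (sg ** u r) = gcoker_proj d (u (sg ** r)).
  by rewrite -gcoker_actE !uK.
pose f : cochain2 (gcoker d) B := Cochain2
  (fun r s => if (r == 0) || (s == 0) then 0 else sval (projE _ _ (fa r s)))
  (fun r sg => if (r == 0) || (sg == 1%g) then 0 else sval (projE _ _ (fs sg r))).
have uf : gpic_reduction u f.
  split=> //.
  - by split=> r /=; rewrite eqxx ?orbT.
  - move=> r s /=; case: eqP => [->/=|_]; first by rewrite u0 raddf0 !add0r.
    case: eqP => [->/=|_]; first by rewrite u0 raddf0 add0r !addr0.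
    by case: (projE _ _ _).
  - move=> r sg /=; case: eqP => [->/=|_].
      by rewrite !gact0 u0 gact0 raddf0 addr0.
    case: eqP => [->/=|_]; first by rewrite !gact1 raddf0 add0r.
    by case: (projE _ _ _).
have [k1 k2 k3 k4] := gpic_reduction_ker uf.
pose h : cochain3 (gcoker d) (gker d) := Cochain3
  (fun r s t => GKer (k1 r s t)) (fun r s => GKer (k2 r s))
  (fun r s sg => GKer (k3 r s sg)) (fun r ta sg => GKer (k4 r ta sg)).
have [[m1 m2 m3 m4] [c1 c2 c3] [c4 c5 c6 c7]] := cobord2_cocycle3 (gpic_norm uf).
have hZ : h \in @Z3_pred _ (gcoker d) (gker d).
  apply/asboolP; split; split.
  - by move=> r s; have [? ? ?] := m1 r s; split; apply: val_inj.
  - by move=> r; have [? ?] := m2 r; split; apply: val_inj.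
  - move=> r s; have [? ? e] := m3 r s.
    by split=> [||r']; apply: val_inj => //; apply: e.
  - by move=> r s t; have [? ? ?] := m4 r s t; split; apply: val_inj.
  - by move=> *; apply: val_inj; apply: c1.
  - by move=> *; apply: val_inj; apply: c2.
  - by move=> *; apply: val_inj; apply: c3.
  - by move=> *; apply: val_inj; apply: c4.
  - by move=> *; apply: val_inj; apply: c5.
  - by move=> *; apply: val_inj; apply: c6.
  - by move=> *; apply: val_inj; apply: c7.
by exists (MkZ3 hZ), u, f.
Qed.

End ReducedCocycle.

Section Extensions.
Variables (Gamma : groupType) (B D : gmodType Gamma) (d : {ghom B -> D}).
Variable Q : gmodType Gamma.

Record extension := Extension {
  ext_E : gmodType Gamma;
  ext_j : {ghom B -> ext_E};
  ext_p : {ghom ext_E -> Q};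
  ext_eps : {ghom ext_E -> D};
  ext_j_inj : injective ext_j;
  ext_exact : forall e, ext_p e = 0 <-> exists b, e = ext_j b;
  ext_p_surj : forall x, exists e, ext_p e = x;
  ext_eps_j : forall b, ext_eps (ext_j b) = d b
}.

Definition ext_equiv (X Y : extension) : Prop :=
  exists alpha : {ghom ext_E X -> ext_E Y},
    [/\ forall b, alpha (ext_j X b) = ext_j Y b,
        forall e, ext_p Y (alpha e) = ext_p X e
      & forall e, ext_eps Y (alpha e) = ext_eps X e].

Lemma ext_equiv_refl X : ext_equiv X X.
Proof.
have FP : zmod_morphism (fun x : ext_E X => x) by [].
have GP s (x : ext_E X) : s ** x = s ** x by [].
pose F := GRing.isZmodMorphism.Build _ _ _ FP.
pose G := isGEquivariant.Build Gamma (ext_E X) (ext_E X) (fun x => x) GP.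
pose alpha : {ghom ext_E X -> ext_E X} := HB.pack (fun x : ext_E X => x) F G.
by exists alpha.
Qed.

Lemma ext_equiv_trans X Y Z : ext_equiv X Y -> ext_equiv Y Z -> ext_equiv X Z.
Proof.
move=> [a [aj ap ae]] [b [bj bp be]].
have FP : zmod_morphism (fun x => b (a x)) by move=> x y; rewrite !raddfB.
have GP s x : b (a (s ** x)) = s ** b (a x) by rewrite !ghomE.
pose F := GRing.isZmodMorphism.Build _ _ _ FP.
pose G := isGEquivariant.Build Gamma _ _ (fun x => b (a x)) GP.
pose c : {ghom ext_E X -> ext_E Z} := HB.pack (fun x => b (a x)) F G.
by exists c; split=> x /=; rewrite ?(aj, bp, be, bj, ap, ae).
Qed.

Lemma ext_equiv_sym X Y : ext_equiv X Y -> ext_equiv Y X.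
Proof.
move=> [a [aj ap ae]].
have a_inj : injective a.
  move=> x y axy; apply/eqP; rewrite -subr_eq0; apply/eqP.
  have a0 : a (x - y) = 0 by rewrite raddfB /= axy subrr.
  have [b xyE] : exists b, x - y = ext_j X b.
    by apply/ext_exact; rewrite -ap a0 raddf0.
  have b0 : b = 0 by apply: (@ext_j_inj Y); rewrite -aj -xyE a0 raddf0.
  by rewrite xyE b0 raddf0.
have a_surj y : exists x, a x = y.
  have [x px] := ext_p_surj X (ext_p Y y).
  have [b e] : exists b, y - a x = ext_j Y b.
    by apply/ext_exact; rewrite raddfB /= ap px subrr.
  by exists (x + ext_j X b); rewrite raddfD /= aj -e addrC subrK.
pose a' y := projT1 (cid (a_surj y)).
have a'K y : a (a' y) = y by rewrite /a'; case: cid.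
have FP : zmod_morphism a' by move=> x y; apply: a_inj; rewrite raddfB /= !a'K.
have GP s x : a' (s ** x) = s ** a' x.
  by apply: a_inj; rewrite ghomE !a'K.
pose F := GRing.isZmodMorphism.Build _ _ _ FP.
pose G := isGEquivariant.Build Gamma _ _ a' GP.
pose c : {ghom ext_E Y -> ext_E X} := HB.pack a' F G.
exists c; split=> x /=; first by apply: a_inj; rewrite a'K aj.
  by rewrite -ap a'K.
by rewrite -ae a'K.
Qed.

Definition ext_induces (psi : {ghom Q -> gcoker d}) (X : extension) : Prop :=
  forall e, psi (ext_p X e) = gcoker_proj d (ext_eps X e).

(* Equivalence classes of the extensions inducing psi; an extension equivalent
   to one inducing psi induces psi as well. *)
Definition ext_class (psi : {ghom Q -> gcoker d}) : Type :=
  {C : extension -> Prop | exists2 X, ext_induces psi X & C = ext_equiv X}.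

End Extensions.

(* Main.v *)
(* An extension of type M inducing psi has a section w with eps w = u psi; its
   failure to be a Gamma-homomorphism is a cocycle F on Q with values in B, and
   d F = d (psi^* f), so that psi^* f - F is a cochain with values in Ker d and
   coboundary psi^* h.  Conversely, if psi^* h is the coboundary of k in Ker d
   then F = psi^* f - k is such a cocycle, and eps (a, r) = d a + u (psi r) turns
   the crossed product of B and Q along F into an extension of type M.  The
   cocycles F in question form a torsor under Z^2 (Q, Ker d); two sections of
   one extension lifting u psi differ by a 1-cochain with values in Ker d, so
   the classes of extensions form a torsor under H^2 (Q, Ker d). *)
Require Import Defs.
From HB Require Import structures.
From mathcomp Require Import all_boot all_algebra.
From mathcomp Require Import ring_quotient boolp functions.

Set Implicit Arguments.
Unset Strict Implicit.
Unset Printing Implicit Defensive.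

Import GRing.Theory.
Local Open Scope ring_scope.
Local Open Scope quotient_scope.

(** * Change of coefficients for cochains and coboundaries *)

Section CochainMap.
Variables (Gamma : groupType) (M : gmodType Gamma).

Definition cochain2_map (N N' : gmodType Gamma) (phi : N -> N')
    (f : cochain2 M N) : cochain2 M N' :=
  Cochain2 (fun r s => phi (c2mm f r s)) (fun r sg => phi (c2mg f r sg)).

Definition cochain3_map (N N' : gmodType Gamma) (phi : N -> N')
    (h : cochain3 M N) : cochain3 M N' :=
  Cochain3 (fun r s t => phi (c3mmm h r s t)) (fun r s => phi (c3mm h r s))
    (fun r s sg => phi (c3mmg h r s sg)) (fun r ta sg => phi (c3mgg h r ta sg)).

(** Lets an identity of cochains be checked after embedding [Ker d] in [B], or [B] in an
    extension. *)
Lemma cochain2_map_inj (N N' : gmodType Gamma) (phi : N -> N') :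
  injective phi -> injective (cochain2_map phi).
Proof.
by move=> phiI [f1 f2] [f1' f2'] [e1 e2]; apply: cochain2P => r s; apply: phiI;
   [move: (congr1 (fun k => k r s) e1)|move: (congr1 (fun k => k r s) e2)].
Qed.

Lemma cochain3_map_inj (N N' : gmodType Gamma) (phi : N -> N') :
  injective phi -> injective (cochain3_map phi).
Proof.
move=> phiI [h1 h2 h3 h4] [h1' h2' h3' h4'] [e1 e2 e3 e4].
apply: cochain3P => [r s t|r s|r s t|r s t]; apply: phiI.
- by move: (congr1 (fun k => k r s t) e1).
- by move: (congr1 (fun k => k r s) e2).
- by move: (congr1 (fun k => k r s t) e3).
- by move: (congr1 (fun k => k r s t) e4).
Qed.

Variables (N N' : gmodType Gamma) (phi : {ghom N -> N'}).

Let phiD x y : phi (x + y) = phi x + phi y. Proof. exact: raddfD. Qed.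
Let phiN x : phi (- x) = - phi x. Proof. exact: raddfN. Qed.
Let phi0 : phi 0 = 0. Proof. exact: raddf0. Qed.

Lemma cochain2_mapB f f' :
  cochain2_map phi (f - f') = cochain2_map phi f - cochain2_map phi f'.
Proof. by apply: cochain2P => r s; apply: (raddfB phi). Qed.

Lemma cochain3_map0 : cochain3_map phi 0 = 0.
Proof. by apply: cochain3P => *; apply: phi0. Qed.

Lemma cobord1_map (g : cochain1 M N) :
  cobord1 (phi \o g : cochain1 M N') = cochain2_map phi (cobord1 g).
Proof. by apply: cochain2P => r s /=; rewrite !(phiD, phiN, ghomE). Qed.

Lemma cobord2_map f : cobord2 (cochain2_map phi f) = cochain3_map phi (cobord2 f).
Proof. by apply: cochain3P => * /=; rewrite !(phiD, phiN, ghomE). Qed.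

Lemma normalized2_map f : normalized2 f -> normalized2 (cochain2_map phi f).
Proof. by case=> n1 n2 n3 n4; split=> r /=; rewrite ?(n1, n2, n3, n4). Qed.

Lemma normalized2_map_inj f : injective phi ->
  normalized2 (cochain2_map phi f) -> normalized2 f.
Proof.
by move=> phiI [n1 n2 n3 n4]; split=> r; apply: phiI; rewrite phi0;
   [apply: n1|apply: n2|apply: n3|apply: n4].
Qed.

Lemma normalized2B (f f' : cochain2 M N) :
  normalized2 f -> normalized2 f' -> normalized2 (f - f').
Proof.
move=> [n1 n2 n3 n4] [n1' n2' n3' n4'].
by split=> r; rewrite cochainBE (n1, n2, n3, n4) (n1', n2', n3', n4') subrr.
Qed.

Lemma normalized2_cobord1 (g : cochain1 M N) :
  normalized1 g -> normalized2 (cobord1 g).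
Proof.
move=> g0; have {}g0 : g 0 = 0 := g0.
by split=> r; rewrite /= ?(add0r, addr0, gact0, gact1) ?g0 ?gact0; zmod.
Qed.

Lemma cobord2_cobord1 (g : cochain1 M N) : cobord2 (cobord1 g) = 0.
Proof.
have aA (x y z : M) : x + (y + z) = x + y + z by rewrite addrA.
apply: cochain3P => [r s t|r s|r s sg|r ta sg]; rewrite /= ?(gactD, gactN, gactM).
- by rewrite !aA; zmod.
- by rewrite (addrC s r); zmod.
- by zmod.
- by zmod.
Qed.

End CochainMap.

(** * Pullback of 2-cochains along a module homomorphism *)

Section CochainPull.
Variables (Gamma : groupType) (M Q N : gmodType Gamma) (psi : {ghom Q -> M}).

Definition cochain2_pull (f : cochain2 M N) : cochain2 Q N :=
  Cochain2 (fun r s => c2mm f (psi r) (psi s)) (fun r sg => c2mg f (psi r) sg).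

Let psiD x y : psi (x + y) = psi x + psi y. Proof. exact: raddfD. Qed.
Let psi0 : psi 0 = 0. Proof. exact: raddf0. Qed.

Lemma cobord2_pull f : cobord2 (cochain2_pull f) = cochain3_pull psi (cobord2 f).
Proof. by apply: cochain3P => * /=; rewrite ?(psiD, ghomE). Qed.

Lemma normalized2_pull f : normalized2 f -> normalized2 (cochain2_pull f).
Proof. by case=> n1 n2 n3 n4; split=> r /=; rewrite ?psi0 ?(n1, n2, n3, n4). Qed.

End CochainPull.

Lemma class2_eq (Gamma : groupType) (M N : gmodType Gamma) (z z' : Z2 M N) :
  \pi_(H2 M N) z = \pi_(H2 M N) z' <->
  exists g : cochain1 M N, normalized1 g /\ z2val z - z2val z' = cobord1 g.
Proof.
have -> : \pi_(H2 M N) z = \pi_(H2 M N) z' <-> z - z' \in @B2_pred _ M N.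
  by rewrite Quotient.idealrBE; split=> [->|/eqP].
by split=> /asboolP.
Qed.

(** * The inclusion of [Ker d] in [B] and lifting of cochains along it *)

Section GKer.
Variables (Gamma : groupType) (B D : gmodType Gamma) (d : {ghom B -> D}).

Fact gker_incl_zmod_morphism : zmod_morphism (@gker_val _ _ _ d).
Proof. by []. Qed.
Fact gker_incl_ghom (s : Gamma) (x : gker d) : gker_val (s ** x) = s ** gker_val x.
Proof. by []. Qed.
HB.instance Definition _ := GRing.isZmodMorphism.Build (gker d) B
  (@gker_val _ _ _ d) gker_incl_zmod_morphism.
HB.instance Definition _ := isGEquivariant.Build Gamma (gker d) B
  (@gker_val _ _ _ d) gker_incl_ghom.

Definition gker_incl : {ghom gker d -> B} := @gker_val _ _ _ d.

Lemma gker_incl_inj : injective gker_incl. Proof. exact: val_inj. Qed.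

Lemma gker_incl_ker x : d (gker_incl x) = 0.
Proof. by case: x => x /= /eqP. Qed.

(** A sigma type, so that cochains can be lifted pointwise. *)
Lemma gker_lift (b : B) : d b = 0 -> {x : gker d | gker_incl x = b}.
Proof. by move=> /eqP db; exists (GKer (db : b \in gker_pred d)). Qed.

Variable M : gmodType Gamma.

Lemma cochain2_gker_lift (f f' : cochain2 M B) :
  cochain2_map d f = cochain2_map d f' ->
  exists k : cochain2 M (gker d), cochain2_map gker_incl k = f - f'.
Proof.
move=> e.
have k1 r s : d (c2mm f r s - c2mm f' r s) = 0.
  have /= e1 := congr1 (fun k => c2mm k r s) e.
  by rewrite raddfB /= e1 subrr.
have k2 r s : d (c2mg f r s - c2mg f' r s) = 0.
  have /= e2 := congr1 (fun k => c2mg k r s) e.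
  by rewrite raddfB /= e2 subrr.
exists (Cochain2 (fun r s => sval (gker_lift (k1 r s)))
                 (fun r s => sval (gker_lift (k2 r s)))).
by apply: cochain2P => r s; apply: (svalP (gker_lift _)).
Qed.

Lemma cochain2_map_gker_incl (k : cochain2 M (gker d)) :
  cochain2_map d (cochain2_map gker_incl k) = 0.
Proof. by apply: cochain2P => *; apply: gker_incl_ker. Qed.

End GKer.

(** * Factor sets of an extension *)

Section FactorSet.
Variables (Gamma : groupType) (B D : gmodType Gamma) (d : {ghom B -> D}).
Variables (Q : gmodType Gamma) (v : cochain1 Q D).
Implicit Types (X Y : extension d Q) (F : cochain2 Q B).

(** The classical factor set [F] of a section [w], for sections with [eps w = v] only. The relation
    [fs_j] lives in [ext_E X], where the coboundary of [w] makes sense; [v] will be [u \o psi]. *)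
Record factor_set X (w : cochain1 Q (ext_E X)) F : Prop := {
  fs0 : w 0 = 0;
  fs_p : forall r, ext_p X (w r) = r;
  fs_eps : forall r, ext_eps X (w r) = v r;
  fs_j : cochain2_map (ext_j X) F = cobord1 w
}.

(** In [ext_E X] the cochain [F] becomes the coboundary of [w], so its own coboundary vanishes
    there; [ext_j] is injective. *)
Lemma factor_set_cocycle2 X w F : @factor_set X w F -> cocycle2 F.
Proof.
move=> fs; split.
  apply: (normalized2_map_inj (@ext_j_inj _ _ _ _ _ X)).
  by rewrite (fs_j fs); apply/normalized2_cobord1/(fs0 fs).
apply: (cochain3_map_inj (@ext_j_inj _ _ _ _ _ X)).
by rewrite -cobord2_map (fs_j fs) cobord2_cobord1 cochain3_map0.
Qed.

Lemma factor_set_map X w F : @factor_set X w F -> cochain2_map d F = cobord1 v.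
Proof.
move=> fs; have -> : v = ext_eps X \o w by apply/funext => r; rewrite /= (fs_eps fs).
rewrite cobord1_map -(fs_j fs).
by apply: cochain2P => r s /=; rewrite ext_eps_j.
Qed.

(** For any lift [e] of [r], [eps e] and [v r] have the same class in [Coker d] because [X] induces
    [psi]; when they differ by [d b], subtracting [j b] corrects [e]. *)
Lemma ex_factor_set (psi : {ghom Q -> gcoker d}) X :
  v 0 = 0 -> (forall r, gcoker_proj d (v r) = psi r) -> ext_induces psi X ->
  exists w F, @factor_set X w F.
Proof.
move=> v0 vE Xpsi.
(* The last clause makes the section obtained by choice normalized. *)
have /choice[w wP] r : exists e, [/\ ext_p X e = r, ext_eps X e = v r
                                   & r = 0 -> e = 0].
  have [->|/eqP r0] := eqVneq r 0; first by exists 0; rewrite !raddf0 v0.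
  have [e pe] := ext_p_surj X r.
  have /gcoker_projP[b eb] : gcoker_proj d (ext_eps X e) = gcoker_proj d (v r).
    by rewrite -Xpsi pe vE.
  have pj : ext_p X (ext_j X b) = 0 by apply/ext_exact; exists b.
  exists (e - ext_j X b); split=> //; rewrite raddfB /= ?pj ?subr0 //.
  by rewrite ext_eps_j -eb subKr.
have w0 : w 0 = 0 by have [_ _] := wP 0; apply.
have wp r : ext_p X (w r) = r by have [] := wP r.
have pD x y : ext_p X (x + y) = ext_p X x + ext_p X y by exact: raddfD.
have pN x : ext_p X (- x) = - ext_p X x by exact: raddfN.
(* [w] is additive and equivariant modulo the kernel of [p], so its defects come from [B]. *)
have k1 r s : {b | ext_j X b = w r + w s - w (r + s)}.
  apply: cid; suff /ext_exact[b ->] : ext_p X (w r + w s - w (r + s)) = 0 by exists b.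
  by rewrite !(pD, pN) !wp subrr.
have k2 r sg : {b | ext_j X b = sg ** w r - w (sg ** r)}.
  apply: cid; suff /ext_exact[b ->] : ext_p X (sg ** w r - w (sg ** r)) = 0 by exists b.
  by rewrite !(pD, pN, ghomE) !wp subrr.
exists w, (Cochain2 (fun r s => sval (k1 r s)) (fun r s => sval (k2 r s))).
split=> // [r|]; first by have [] := wP r.
by apply: cochain2P => r s /=; [case: (k1 r s)|case: (k2 r s)].
Qed.

(** [w - w'] is killed by [p], hence comes from [B], and by [eps], hence comes from [Ker d]. *)
Lemma factor_set_uniq X w F w' F' : @factor_set X w F -> @factor_set X w' F' ->
  exists g : cochain1 Q (gker d),
    normalized1 g /\ F - F' = cochain2_map (gker_incl d) (cobord1 g).
Proof.
move=> fs fs'.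
have k r : {x : gker d | ext_j X (gker_incl d x) = w r - w' r}.
  apply: cid; have /ext_exact[b eb] : ext_p X (w r - w' r) = 0.
    by rewrite raddfB /= (fs_p fs) (fs_p fs') subrr.
  have db : d b = 0.
    by rewrite -(ext_eps_j X) -eb raddfB /= (fs_eps fs) (fs_eps fs') subrr.
  by have [x xb] := gker_lift db; exists x; rewrite xb.
pose g r := sval (k r); have gE r : ext_j X (gker_incl d (g r)) = w r - w' r.
  exact: svalP (k r).
exists g; split.
  apply: (@gker_incl_inj _ _ _ d); apply: (@ext_j_inj _ _ _ _ _ X).
  by rewrite gE (fs0 fs) (fs0 fs') !raddf0 addr0.
apply: (cochain2_map_inj (@ext_j_inj _ _ _ _ _ X)).
rewrite cochain2_mapB (fs_j fs) (fs_j fs') -!cobord1_map -cobord1B.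
by congr cobord1; apply/funext => r; rewrite /= gE.
Qed.

(** Subtract [j g] from the section: neither [p] nor [eps] sees the change, since [p j = 0] and
    [d g = 0]. *)
Lemma factor_set_change X w F (g : cochain1 Q (gker d)) : normalized1 g ->
  @factor_set X w F ->
  exists w', @factor_set X w' (F - cochain2_map (gker_incl d) (cobord1 g)).
Proof.
move=> g0 fs; have {}g0 : g 0 = 0 := g0.
pose g' r := ext_j X (gker_incl d (g r)).
have pg' r : ext_p X (g' r) = 0 by apply/ext_exact; eexists.
exists (w - (g' : cochain1 Q (ext_E X))); split.
- by rewrite -[LHS]/(w 0 - g' 0) (fs0 fs) /g' g0 !raddf0 addr0.
- by move=> r; rewrite [LHS](raddfB (ext_p X)) /= pg' (fs_p fs) subr0.
- move=> r; rewrite [LHS](raddfB (ext_eps X)) /= (fs_eps fs).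
  by rewrite /g' ext_eps_j gker_incl_ker subr0.
- by rewrite cobord1B cochain2_mapB (fs_j fs) -!cobord1_map.
Qed.

(** The equivalence carries [w] to a section of [Y], and [F] is unchanged because the copies of [B]
    correspond. *)
Lemma factor_set_equiv X Y w F : ext_equiv X Y -> @factor_set X w F ->
  exists w', @factor_set Y w' F.
Proof.
move=> [a [aj ap ae]] fs; exists (a \o w); split.
- by rewrite /= (fs0 fs) raddf0.
- by move=> r; rewrite /= ap (fs_p fs).
- by move=> r; rewrite /= ae (fs_eps fs).
- rewrite cobord1_map -(fs_j fs).
  by apply: cochain2P => r s /=; rewrite aj.
Qed.

End FactorSet.

(** * The crossed product of [B] and [Q] along a cocycle *)

Section Crossed.
Variables (Gamma : groupType) (B Q : gmodType Gamma) (F : cochain2 Q B).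
Hypothesis cF : cocycle2 F.

(* The proof is an argument of the type so that the zmodType and gmodType
   structures can be inferred from it. *)
Definition crossed of cocycle2 F : Type := (B * Q)%type.
Local Notation E := (crossed cF).

HB.instance Definition _ := Choice.copy E (B * Q)%type.

(** The pair [(a, r)] stands for [j a + w r]; the formulas are forced by [j F = cobord1 w]. *)
Definition crossed_add (x y : E) : E :=
  (x.1 + y.1 + c2mm F x.2 y.2, x.2 + y.2).
Definition crossed_opp (x : E) : E := (- x.1 - c2mm F (- x.2) x.2, - x.2).
Definition crossed_act (s : Gamma) (x : E) : E :=
  (s ** x.1 + c2mg F x.2 s, s ** x.2).

(** The components of [cobord2 F = 0] in balanced form: [FA] gives associativity, [FC]
    commutativity, [FG] additivity of the action, [FGG] its multiplicativity; normalization handles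
    [0] and [1]. *)
Let F0r r : c2mm F 0 r = 0. Proof. by case: cF => -[]. Qed.
Let Fr1 r : c2mg F r 1%g = 0. Proof. by case: cF => -[]. Qed.
Let FA r s t : c2mm F s t + c2mm F r (s + t) = c2mm F (r + s) t + c2mm F r s.
Proof.
apply/eqP; rewrite -subr_eq0; apply/eqP.
by case: cF => _ /(congr1 (fun k => c3mmm k r s t)) /= <-; zmod.
Qed.
Let FC r s : c2mm F s r = c2mm F r s.
Proof.
apply/eqP; rewrite -subr_eq0; apply/eqP.
by case: cF => _ /(congr1 (fun k => c3mm k r s)).
Qed.
Let FG r s sg : c2mg F r sg + c2mg F s sg + c2mm F (sg ** r) (sg ** s)
  = sg ** c2mm F r s + c2mg F (r + s) sg.
Proof.
apply/eqP; rewrite -subr_eq0; apply/eqP.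
by case: cF => _ /(congr1 (fun k => c3mmg k r s sg)) /= <-; zmod.
Qed.
Let FGG r ta sg :
  c2mg F r (ta * sg)%g = ta ** c2mg F r sg + c2mg F (sg ** r) ta.
Proof.
apply/esym/eqP; rewrite -subr_eq0; apply/eqP.
by case: cF => _ /(congr1 (fun k => c3mgg k r ta sg)).
Qed.

Fact crossed_addA : associative crossed_add.
Proof.
move=> [a r] [b s] [c t]; congr pair; rewrite /= ?addrA //.
have e := FA r s t.
transitivity (a + b + c + (c2mm F s t + c2mm F r (s + t))); first by zmod.
by rewrite e; zmod.
Qed.
Fact crossed_addC : commutative crossed_add.
Proof.
move=> [a r] [b s]; congr pair; rewrite /= 1?addrC //.
by rewrite FC (addrC a); zmod.
Qed.
Fact crossed_add0 : left_id (0 : B * Q) crossed_add.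
Proof. by move=> [a r]; congr pair; rewrite /= ?F0r ?addr0 add0r. Qed.
Fact crossed_addN : left_inverse (0 : B * Q) crossed_opp crossed_add.
Proof. by move=> [a r]; congr pair; rewrite /= ?addNr //; zmod. Qed.

HB.instance Definition _ := GRing.isZmodule.Build E
  crossed_addA crossed_addC crossed_add0 crossed_addN.

Fact crossed_act1 x : crossed_act 1%g x = x.
Proof. by case: x => a r; congr pair; rewrite /= ?Fr1 ?addr0 gact1. Qed.
Fact crossed_actM s t x : crossed_act (s * t)%g x = crossed_act s (crossed_act t x).
Proof.
by case: x => a r; congr pair; rewrite /= ?FGG !(gactM, gactD) //; zmod.
Qed.
Fact crossed_actD s x y :
  crossed_act s (x + y) = crossed_act s x + crossed_act s y.
Proof.
case: x y => [a r] [b t]; congr pair; rewrite /= !gactD //.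
transitivity (s ** a + s ** b + (s ** c2mm F r t + c2mg F (r + t) s)).
  by zmod.
by rewrite -FG; zmod.
Qed.

HB.instance Definition _ :=
  isGModule.Build Gamma E crossed_act1 crossed_actM crossed_actD.

Lemma crossedDE (x y : E) : x + y = (x.1 + y.1 + c2mm F x.2 y.2, x.2 + y.2).
Proof. by []. Qed.
Lemma crossed_gactE s (x : E) : s ** x = (s ** x.1 + c2mg F x.2 s, s ** x.2).
Proof. by []. Qed.

(** The hypothesis says that the values [w r] satisfy the relations of the section [r -> (0, r)], so
    [k] extends over the crossed product. It yields both [eps] and the equivalences out of a crossed
    product. *)
Lemma crossed_ghom (N : gmodType Gamma) (k : {ghom B -> N}) (w : cochain1 Q N) :
  cochain2_map k F = cobord1 w ->
  exists alpha : {ghom E -> N}, forall x, alpha x = k x.1 + w x.2.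
Proof.
move=> e.
have e1 r s : k (c2mm F r s) = w r + w s - w (r + s).
  exact: (congr1 (fun f => c2mm f r s) e).
have e2 r s : k (c2mg F r s) = s ** w r - w (s ** r).
  exact: (congr1 (fun f => c2mg f r s) e).
pose a (x : E) := k x.1 + w x.2.
have kD x y : k (x + y) = k x + k y by exact: raddfD.
have aD x y : a (x + y) = a x + a y by rewrite /a /= !kD e1; zmod.
have aB : zmod_morphism a.
  move=> x y; apply: (@addIr _ (a y)); rewrite -aD !subrK //.
have aG s x : a (s ** x) = s ** a x.
  by rewrite /a /= kD e2 gactD ghomE; zmod.
pose F1 := GRing.isZmodMorphism.Build _ _ _ aB.
pose G1 := isGEquivariant.Build Gamma E N a aG.
pose alpha : {ghom E -> N} := HB.pack a F1 G1.
by exists alpha.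
Qed.

End Crossed.

(** * Extensions with a given factor set, and their classification *)

Section CrossedExtension.
Variables (Gamma : groupType) (B D : gmodType Gamma) (d : {ghom B -> D}).
Variables (Q : gmodType Gamma) (v : cochain1 Q D).

(** The section [r -> (0, r)] has factor set [F]. For any extension with factor set [F], the map
    [(a, r) -> j a + w r] is an equivalence, so [F] determines the class. *)
Lemma crossed_extension (F : cochain2 Q B) :
  cocycle2 F -> cochain2_map d F = cobord1 v ->
  exists2 X : extension d Q, exists w, factor_set v (X := X) w F
    & forall (Y : extension d Q) w, factor_set v (X := Y) w F -> ext_equiv X Y.
Proof.
move=> cF dF; pose E : gmodType Gamma := crossed cF.
have [[F0r Fr0 F0g _] _] := cF.
have jP : zmod_morphism (fun b => (b, 0) : E).
  move=> a b; apply: (@addIr _ ((b, 0) : E)); rewrite subrK crossedDE.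
  by congr pair; rewrite /= ?F0r ?addr0 // subrK.
have jG s b : ((s ** b, 0) : E) = s ** ((b, 0) : E).
  by rewrite crossed_gactE /= F0g gact0 addr0.
pose j : {ghom B -> E} := HB.pack (fun b => (b, 0) : E)
  (GRing.isZmodMorphism.Build _ _ _ jP) (isGEquivariant.Build Gamma B E _ jG).
have pP : zmod_morphism (fun x : E => x.2) by [].
have pG s (x : E) : (s ** x).2 = s ** x.2 by [].
pose p : {ghom E -> Q} := HB.pack (fun x : E => x.2)
  (GRing.isZmodMorphism.Build _ _ _ pP) (isGEquivariant.Build Gamma E Q _ pG).
have [eps epsE] := crossed_ghom cF dF.
have d0 : d 0 = 0 by exact: raddf0.
(* As [F (0, 0) = 0], evaluating [d F = cobord1 v] at [(0, 0)] leaves [v 0 = 0]. *)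
have v0 : v 0 = 0.
  have /= := congr1 (fun k => c2mm k 0 0) dF.
  by rewrite F0r d0 !addr0 addrK.
have j_inj : injective j by move=> a b [].
have exact_jp e : p e = 0 <-> exists b, e = j b.
  by case: e => a r; split=> [/= ->|[b ->]] //; exists a.
have p_surj x : exists e, p e = x by exists (0, x).
have eps_j b : eps (j b) = d b by rewrite epsE /= v0 addr0.
exists (Extension j_inj exact_jp p_surj eps_j).
  exists (fun r => (0, r) : E); split=> //=.
  - by move=> r; rewrite epsE /= d0 add0r.
  - apply: cochain2P => r s /=; apply/esym/eqP; rewrite subr_eq; apply/eqP.
      by rewrite !crossedDE; congr pair; rewrite /= ?F0r ?addr0 add0r.
    rewrite crossed_gactE crossedDE.
    by congr pair; rewrite /= ?F0r ?gact0 ?addr0 add0r.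
move=> Y w fs; have [alpha alphaE] := crossed_ghom cF (fs_j fs).
have w0 := fs0 fs.
exists alpha; split=> [b|x|x] /=; rewrite alphaE /=.
- by rewrite w0 addr0.
- rewrite raddfD /= (fs_p fs); have -> : ext_p Y (ext_j Y x.1) = 0.
    by apply/ext_exact; exists x.1.
  by rewrite add0r.
- by rewrite raddfD /= ext_eps_j (fs_eps fs) epsE.
Qed.

Variable psi : {ghom Q -> gcoker d}.
Hypothesis vE : forall r, gcoker_proj d (v r) = psi r.

(** [w (p e) - e] comes from [B], so [eps] sends it into the image of [d]. *)
Lemma factor_set_induces (X : extension d Q) w F :
  factor_set v (X := X) w F -> ext_induces psi X.
Proof.
move=> fs e; rewrite -vE -(fs_eps fs); apply/gcoker_projP.
have /ext_exact[b eb] : ext_p X (w (ext_p X e) - e) = 0.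
  by rewrite raddfB /= (fs_p fs) subrr.
by exists b; rewrite -(raddfB (ext_eps X)) /= eb ext_eps_j.
Qed.

Hypothesis v0 : v 0 = 0.

(** With [F0] as base point, [T] sends [c] to the class of the extension with factor set [F0 - z],
    for a chosen cocycle [z] in [c]. The bijection [G] is the inverse of [T]. *)
Lemma ext_class_bij (F0 : cochain2 Q B) :
  cocycle2 F0 -> cochain2_map d F0 = cobord1 v ->
  exists G : ext_class psi -> H2 Q (gker d), bijective G.
Proof.
move=> [nF0 cF0] dF0.
pose Fc (c : H2 Q (gker d)) := F0 - cochain2_map (gker_incl d) (z2val (repr c)).
have cFc c : cocycle2 (Fc c).
  have : cocycle2 (z2val (repr c)) by case: (repr c) => z /= /asboolP.
  move=> [nz cz]; split; first by apply: normalized2B => //; apply: normalized2_map.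
  by rewrite cobord2B cobord2_map cF0 cz cochain3_map0 subrr.
have dFc c : cochain2_map d (Fc c) = cobord1 v.
  by rewrite cochain2_mapB cochain2_map_gker_incl subr0.
have X_ c := cid2 (crossed_extension (cFc c) (dFc c)).
pose X c := s2val (X_ c).
have [XF XU] : (forall c, exists w, factor_set v (X := X c) w (Fc c)) /\
    forall c (Y : extension d Q) w,
      factor_set v (X := Y) w (Fc c) -> ext_equiv (X c) Y.
  by split=> c; [exact: (s2valP (X_ c))|exact: (s2valP' (X_ c))].
have Xpsi c : ext_induces psi (X c) by have [w /factor_set_induces] := XF c.
pose T c : ext_class psi := exist _ (ext_equiv (X c)) (ex_intro2 _ _ _ (Xpsi c) erefl).
(* If [X c] and [X c'] are equivalent, [Fc c] and [Fc c'] are both factor sets of [X c'], so they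
   differ by the coboundary of a 1-cochain in [Ker d]. *)
have T_inj : injective T.
  move=> c c' /(congr1 sval) /= eT.
  have [w fs] := XF c; have [w' fs'] := XF c'.
  have XX : ext_equiv (X c) (X c') by rewrite eT; apply: ext_equiv_refl.
  have [w2 fs2] := factor_set_equiv XX fs.
  have [g [g0 eg]] := factor_set_uniq fs' fs2.
  rewrite -[c]reprK -[c']reprK; apply/class2_eq; exists g; split=> //.
  apply: (cochain2_map_inj (@gker_incl_inj _ _ _ d)).
  by rewrite cochain2_mapB -eg /Fc; zmod.
have T_surj C : exists c, T c = C.
  case: C => C [Y Ypsi eC]; have [w [F fs]] := ex_factor_set v0 vE Ypsi.
  have [nF cF] := factor_set_cocycle2 fs.
  (* [F0] and [F] have the same image under [d]; the class of their difference is the preimage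
     sought. *)
  have [k kE] : exists k, cochain2_map (gker_incl d) k = F0 - F.
    by apply: cochain2_gker_lift; rewrite dF0 (factor_set_map fs).
  have kZ : k \in @Z2_pred _ Q (gker d).
    apply/asboolP; split.
      apply: (normalized2_map_inj (@gker_incl_inj _ _ _ d)).
      by rewrite kE; apply: normalized2B.
    apply: (cochain3_map_inj (@gker_incl_inj _ _ _ d)).
    by rewrite -cobord2_map kE cobord2B cF0 cF subrr cochain3_map0.
  pose c : H2 Q (gker d) := \pi_(H2 Q (gker d)) (MkZ2 kZ); exists c.
  (* [repr c] need not be [k]; shifting the section of [Y] by [g] absorbs the difference. *)
  have /class2_eq[g [g0 eg]] : \pi_(H2 Q (gker d)) (repr c) = c by rewrite reprK.
  have [w' fs'] := factor_set_change g0 fs.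
  have XY : ext_equiv (X c) Y.
    apply: (XU c Y w').
    suff -> : Fc c = F - cochain2_map (gker_incl d) (cobord1 g) by [].
    by rewrite -eg cochain2_mapB /= kE /Fc; zmod.
  apply: eq_exist; rewrite /= eC; apply/funext => Z; apply/propext; split.
    by apply: ext_equiv_trans; apply: ext_equiv_sym.
  exact: ext_equiv_trans.
pose G C := sval (cid (T_surj C)).
have GK C : T (G C) = C by rewrite /G; case: cid.
by exists G, T => // c; apply: T_inj; rewrite GK.
Qed.

End CrossedExtension.

(** * The obstruction class *)

Section Obstruction.
Variables (Gamma : groupType) (B D : gmodType Gamma) (d : {ghom B -> D}).
Variables (Q : gmodType Gamma) (psi : {ghom Q -> gcoker d}).
Variables (h : Z3 (gcoker d) (gker d)) (u : gcoker d -> D).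
Variable f : cochain2 (gcoker d) B.
Hypothesis uf : gpic_reduction u f.
Hypothesis hf : cochain3_gker (z3val h) = cobord2 f.

(** The pullback [f0] of [f] satisfies the condition on [d F], but its coboundary is the pullback of
    [h]. The other solutions are [f0 - k] with [k] in [Ker d], closed exactly when [cobord2 k] is
    that pullback. *)
Lemma class3_pull_eq0 :
  class3 (Z3_pull psi h) = 0 <->
  exists2 F : cochain2 Q B, cocycle2 F
    & cochain2_map d F = cobord1 (u \o psi : cochain1 Q D).
Proof.
pose f0 := cochain2_pull psi f.
have nf0 : normalized2 f0 := normalized2_pull psi (gpic_norm uf).
have cf0 : cobord2 f0 = cochain3_map (gker_incl d) (z3val (Z3_pull psi h)).
  by rewrite cobord2_pull -hf.
have df0 : cochain2_map d f0 = cobord1 (u \o psi : cochain1 Q D).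
  apply: cochain2P => r s /=; apply/esym/eqP; rewrite subr_eq.
    by rewrite raddfD -(gpic_add uf).
  by rewrite ghomE -(gpic_act uf).
rewrite class3_eq0; split=> [[k [nk ck]]|[F [nF cF] dF]].
  exists (f0 - cochain2_map (gker_incl d) k).
    split; first by apply: normalized2B => //; apply: normalized2_map.
    by rewrite cobord2B cobord2_map -ck cf0 subrr.
  by rewrite cochain2_mapB cochain2_map_gker_incl subr0.
have [k kE] : exists k, cochain2_map (gker_incl d) k = f0 - F.
  by apply: cochain2_gker_lift; rewrite df0 dF.
exists k; split.
  apply: (normalized2_map_inj (@gker_incl_inj _ _ _ d)).
  by rewrite kE; apply: normalized2B.
apply: (cochain3_map_inj (@gker_incl_inj _ _ _ d)).
by rewrite -cobord2_map kE cobord2B cF subr0 cf0.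
Qed.

End Obstruction.

Theorem theorem5p4 (Gamma : groupType) (B D : gmodType Gamma)
    (d : {ghom B -> D}) (Q : gmodType Gamma) (psi : {ghom Q -> gcoker d})
    (h : Z3 (gcoker d) (gker d)) :
  gpic_cocycle h ->
  (class3 (Z3_pull psi h) = 0 <->
     exists X : extension d Q, ext_induces psi X)
  /\ (class3 (Z3_pull psi h) = 0 ->
     exists F : ext_class psi -> H2 Q (gker d), bijective F).
Proof.
move=> [u [f [uf hf]]]; rewrite (class3_pull_eq0 psi uf hf).
(* All factor sets are taken relative to this lift of [psi] to [D]. *)
pose v : cochain1 Q D := u \o psi.
have vE r : gcoker_proj d (v r) = psi r by rewrite /v /= (gpic_uK uf).
have v0 : v 0 = 0 by rewrite /v /= raddf0 (gpic_u0 uf).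
split; last by move=> [F cF dF]; apply: (ext_class_bij vE v0 cF dF).
split=> [[F cF dF]|[X Xpsi]].
  by have [X [w /(factor_set_induces vE)]] := crossed_extension cF dF; exists X.
have [w [F fs]] := ex_factor_set v0 vE Xpsi.
by exists F; [apply: factor_set_cocycle2 fs|apply: factor_set_map fs].
Qed.
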